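(* Let $A \in \mathbb{C}^{d\times d}$ be diagonalizable with eigenvalues $\lambda = (\lambda_0,\dots,\lambda_{d-1})^{\mathrm{T}} \in \mathbb{C}^d$, and let $\phi \in \mathbb{C}^d$. For every $L \ge d$, the family $\{A^\ell \phi\}_{\ell=0}^{L-1}$ is a full-spark frame for $\mathbb{C}^d$ if and only if $\phi$ depends on all eigenvectors of $A$ and the Vandermonde matrix $V_\lambda \in \mathbb{C}^{d\times L}$ has full spark.
   Context: The eigenvalues in $\lambda$ are listed with multiplicity. Write $A = S\,\mathrm{diag}(\lambda_0,\dots,\lambda_{d-1})\,S^{-1}$ with $S\in\mathbb{C}^{d\times d}$ invertible, whose columns are eigenvectors of $A$; ''$\phi$ depends on all eigenvectors'' means that every coordinate of $S^{-1}\phi$ is non-zero. The Vandermonde matrix generated by $\lambda$ is $V_\lambda = (\lambda_k^{\ell})_{k,\ell=0}^{d-1,L-1} \in \mathbb{C}^{d\times L}$ (row index $k$, column index $\ell$, with $0^0=1$). A family of $L \ge d$ vectors in $\mathbb{C}^d$ is a frame for $\mathbb{C}^d$ if it spans $\mathbb{C}^d$; a frame $\{f_k\}_{k=0}^{L-1}$ (an indexed family) has full spark, i.e. is a full-spark frame, if every subfamily of $d$ elements (with distinct indices) spans $\mathbb{C}^d$. A matrix in $\mathbb{C}^{d\times L}$ has full spark if its columns do, i.e. if every $d\times d$ submatrix formed by $d$ distinct columns is invertible. *)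

(* Defs.v *)
From mathcomp Require Import all_boot all_order all_algebra.
From mathcomp Require Import reals complex.

Set Implicit Arguments.
Unset Strict Implicit.
Unset Printing Implicit Defensive.

Import GRing.Theory.
Local Open Scope ring_scope.

Definition is_frame (K : fieldType) (d L : nat) (f : 'I_L -> 'cV[K]_d) : Prop :=
  <<[seq f i | i : 'I_L]>>%VS = fullv.

(* A subfamily is given by a set J of indices, not of vectors: the vectors
   f i, i in J, may coincide. *)
Definition full_spark_frame (K : fieldType) (d L : nat)
    (f : 'I_L -> 'cV[K]_d) : Prop :=
  is_frame f /\
  forall J : {set 'I_L}, #|J| = d -> <<[seq f i | i in J]>>%VS = fullv.

Definition full_spark_mx (K : fieldType) (d L : nat) (V : 'M[K]_(d, L)) : Prop :=
  full_spark_frame (fun j => col j V).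

(* The entry in row k, column l is lam_k ^+ l; the library's Vandermonde matrix
   is the transpose. *)
Definition vandermonde (K : fieldType) (d L : nat) (lam : 'cV[K]_d) :
    'M[K]_(d, L) :=
  (Vandermonde L lam^T)^T.

(* S is an invertible matrix whose columns are eigenvectors. *)
Definition depends_on_all_eigenvectors (K : fieldType) (d : nat)
    (S : 'M[K]_d) (phi : 'cV[K]_d) : Prop :=
  forall k : 'I_d, (invmx S *m phi) k 0 != 0.

(* Main.v *)
Require Import Defs.
From mathcomp Require Import all_boot all_order all_algebra.
From mathcomp Require Import reals complex.

(** Put [c = S^-1 phi].  Since [A = S diag(lam) S^-1], we have
    [A^l phi = S diag(lam)^l c = (S diag(c)) v_l], where [v_l], the vector of
    the powers [lam_k^l], is the [l]-th column of the Vandermonde matrix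
    ([orbit_vandermonde]).  So the orbit of [phi] is the image of the columns of
    the Vandermonde matrix under the single matrix [M = S diag(c)].

    The image under [M] of a finite family spans the whole space if and only if
    [M] is invertible and the family itself spans ([span_mulmx_full]); hence the
    image of a family under [M] is a full-spark frame if and only if [M] is
    invertible and the family is a full-spark frame ([full_spark_frame_mulmx]).
    Finally, [S diag(c)] is invertible exactly when no coordinate of [c]
    vanishes. *)

Import GRing.Theory.
Local Open Scope ring_scope.
Local Open Scope complex_scope.

Lemma span_mulmx_full {K : fieldType} {d : nat} (M : 'M[K]_d)
    (X : seq 'cV[K]_d) :
  <<[seq M *m v | v <- X]>>%VS = fullv <-> M \in unitmx /\ <<X>>%VS = fullv.
Proof.
have spanE (N : 'M[K]_d) (Y : seq 'cV[K]_d) :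
    <<[seq N *m v | v <- Y]>>%VS = (linfun (mulmx N) @: <<Y>>)%VS.
  by rewrite limg_span; congr span; apply: eq_map => v; rewrite lfunE.
have imgT (N : 'M[K]_d) :
    N \in unitmx -> (linfun (mulmx N) @: fullv)%VS = fullv.
  move=> N_unit; apply/eqP; rewrite eqEsubv subvf; apply/subvP=> w _.
  by apply/memv_imgP; exists (invmx N *m w); rewrite ?memvf // lfunE /= mulKVmx.
split=> [spanMX | [M_unit spanX]]; last by rewrite spanE spanX imgT.
have surjM (w : 'cV[K]_d) : {v : 'cV[K]_d | M *m v = w}.
  have /memv_imgP/sig2_eqW[v _ ->] :
    w \in (linfun (mulmx M) @: <<X>>)%VS by rewrite -spanE spanMX memvf.
  by exists v; rewrite lfunE.
have M_unit : M \in unitmx.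
  (* A right inverse of M, built column by column. *)
  pose B : 'M[K]_d := \matrix_(i, j) sval (surjM (col j 1%:M)) i 0.
  suff /mulmx1_unit[] : M *m B = 1%:M by [].
  apply/matrixP=> i j; have /colP/(_ i) := svalP (surjM (col j 1%:M)).
  by rewrite !mxE => <-; apply: eq_bigr => k _; rewrite mxE.
split=> //.
(* The family X is the image of its image under the inverse of M. *)
have -> : X = [seq invmx M *m v | v <- [seq M *m v | v <- X]].
  by rewrite -map_comp -[LHS]map_id; apply: eq_map => v /=; rewrite mulKmx.
by rewrite spanE spanMX imgT ?unitmx_inv.
Qed.

Lemma full_spark_frame_mulmx {K : fieldType} {d L : nat} (M : 'M[K]_d)
    (f g : 'I_L -> 'cV[K]_d) :
  (forall l, g l = M *m f l) ->
  full_spark_frame g <-> M \in unitmx /\ full_spark_frame f.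
Proof.
move=> gE.
have imE (J : pred 'I_L) :
    [seq g i | i in J] = [seq M *m v | v <- [seq f i | i in J]].
  by rewrite -map_comp; apply: eq_map.
rewrite /full_spark_frame /is_frame imE; split.
  move=> [/span_mulmx_full[M_unit spanf] sparkf]; split=> //; split=> // J cardJ.
  by have := sparkf J cardJ; rewrite imE => /span_mulmx_full[].
move=> [M_unit [spanf sparkf]]; split; first exact/span_mulmx_full.
by move=> J cardJ; rewrite imE; apply/span_mulmx_full; split=> //; apply: sparkf.
Qed.

Lemma diag_mx_unit {K : fieldType} {d : nat} (c : 'rV[K]_d) :
  diag_mx c \in unitmx <-> forall k, c 0 k != 0.
Proof.
rewrite unitmxE det_diag unitfE; split=> [/prodf_neq0 c0 k | c0].
  exact: c0.
by apply/prodf_neq0 => k _; apply: c0.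
Qed.

Lemma orbit_vandermonde {K : fieldType} {d L : nat} (S : 'M[K]_d)
    (lam phi : 'cV[K]_d) (l : 'I_L) :
  S \in unitmx ->
  (S *m diag_mx lam^T *m invmx S) ^+ l *m phi =
  S *m diag_mx (invmx S *m phi)^T *m col l (vandermonde L lam).
Proof.
move=> S_unit.
have powE (n : nat) : (S *m diag_mx lam^T *m invmx S) ^+ n *m phi =
    S *m (\col_k (lam k 0 ^+ n * (invmx S *m phi) k 0)).
  elim: n => [|n IHn].
    rewrite expr0 mul1mx -[LHS](mulKVmx S_unit); congr (S *m _).
    by apply/colP=> k; rewrite [RHS]mxE expr0 mul1r.
  rewrite exprS -[_ * _]/(_ *m _) -mulmxA IHn -!mulmxA mulKmx //.
  by congr (S *m _); rewrite mul_diag_mx; apply/colP=> k; rewrite !mxE exprS mulrA.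
rewrite powE -mulmxA; congr (S *m _); rewrite mul_diag_mx; apply/colP=> k.
by rewrite !mxE mulrC.
Qed.

Theorem theorem4p1 (R : realType) (d : nat) (A : 'M[R[i]]_d) (lam : 'cV[R[i]]_d)
  (S : 'M[R[i]]_d) (phi : 'cV[R[i]]_d)
  (S_unit : S \in unitmx)
  (A_diag : A = S *m diag_mx lam^T *m invmx S)
  (L : nat) (dL : (d <= L)%N) :
  full_spark_frame (fun l : 'I_L => A ^+ l *m phi) <->
  depends_on_all_eigenvectors S phi /\ full_spark_mx (vandermonde L lam).
Proof.
set M := S *m diag_mx (invmx S *m phi)^T.
have orbitE (l : 'I_L) : A ^+ l *m phi = M *m col l (vandermonde L lam).
  by rewrite A_diag orbit_vandermonde.
have unitM : M \in unitmx <-> depends_on_all_eigenvectors S phi.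
  rewrite unitmx_mul S_unit /=; apply: (iff_trans (diag_mx_unit _)).
  by split=> c0 k; have := c0 k; rewrite [_^T _ _]mxE.
by apply: (iff_trans (full_spark_frame_mulmx _ _ _ orbitE)); rewrite unitM.
Qed.
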